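(* Let $X_0,X_1,Y_0,Y_1,Z$ be quasi-normed spaces, where $X_0,X_1$ are linear subspaces of a common real vector space and $Y_0,Y_1$ are linear subspaces of a common real vector space. Let $$\tau:(X_0\cap X_1)\times(Y_0\cap Y_1)\to Z$$ be a bilinear operator with $$\|\tau(f,g)\|_Z\le\|f\|_{X_0}\|g\|_{Y_0}+\|f\|_{X_1}\|g\|_{Y_1}\qquad\text{for all } f\in X_0\cap X_1,\ g\in Y_0\cap Y_1.$$ Let $n\ge1$. Then for all $\vec f=(f_1,\dots,f_n)\in(X_0\cap X_1)^n$ and $\vec g=(g_1,\dots,g_n)\in(Y_0\cap Y_1)^n$, $$\|\tau(\vec f,\vec g)\|_Z:=\Big\|\sum_{i=1}^n\tau(f_i,g_i)\Big\|_Z\le C\Big(\big|[\vec f]_{X_0}[\vec g]_{Y_0}\big|+\big|[\vec f]_{X_1}[\vec g]_{Y_1}\big|\Big),$$ where the constant $C$ depends only on $n$.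
   Context: All vector spaces are real. A quasi-norm satisfies the axioms of a norm except that the triangle inequality is relaxed to $\|x+y\|\le K(\|x\|+\|y\|)$ for a constant $K\ge1$ (the quasi-triangle constant); a quasi-normed space is a vector space with a quasi-norm, not necessarily complete. Reducing matrices: for a quasi-normed space $X$ with quasi-triangle constant $K$, $\vec x=(x_1,\dots,x_n)\in X^n\cong X\otimes\mathbb R^n$ and $\vec e=(e_1,\dots,e_n)\in\mathbb R^n$, put $\vec x\cdot\vec e:=\sum_{i=1}^n e_ix_i\in X$. Then $\vec e\mapsto\|\vec x\cdot\vec e\|_X$ is a semi-quasi-norm on $\mathbb R^n$ (a quasi-norm except that it may vanish on nonzero vectors), and $[\vec x]_X$ denotes a positive semi-definite $n\times n$ matrix with $$c^{-1}\,|[\vec x]_X\vec e|\le\|\vec x\cdot\vec e\|_X\le c\,|[\vec x]_X\vec e|\qquad\forall\vec e\in\mathbb R^n,$$ where $c\ge1$ depends only on $n$ and $K$; such a matrix always exists. It is not unique, but any fixed choice may be used. $|\cdot|$ is the Euclidean norm of vectors and the corresponding operator norm of matrices.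
   Formalization: The constant C depends on n and also on the quasi-triangle constants of X_0, X_1, Y_0, Y_1, Z and the fixed convention c(n,K) for reducing matrices; dependence on n alone fails for general quasi-norms. *)

(* Defs.v *)
From HB Require Import structures.
From mathcomp Require Import all_boot all_order all_algebra.
From mathcomp Require Import classical_sets reals.

Set Implicit Arguments.
Unset Strict Implicit.
Unset Printing Implicit Defensive.
Import Order.TTheory GRing.Theory Num.Theory.
Local Open Scope ring_scope.

(* A quasi-norm on a subspace X of V is given by a function on all of V; only
   its values on X are constrained. The space X itself need not be complete. *)
Definition quasi_norm (R : realType) (V : lmodType R) (X : {pred V})
    (q : V -> R) (K : R) : Prop :=
  [/\ 1 <= K,
      {in X, forall x, 0 <= q x},
      {in X, forall x, q x = 0 -> x = 0},
      (forall a : R, {in X, forall x, q (a *: x) = `|a| * q x})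
    & {in X &, forall x y, q (x + y) <= K * (q x + q y)}].

(* Bilinearity of a map defined on the product of the subspaces A and B; its
   values off A x B are irrelevant. *)
Definition bilinear_on (R : realType) (V W Z : lmodType R)
    (A : {pred V}) (B : {pred W}) (tau : V -> W -> Z) : Prop :=
  (forall a : R, {in A &, forall x x', {in B, forall y,
     tau (a *: x + x') y = a *: tau x y + tau x' y}}) /\
  (forall a : R, {in A, forall x, {in B &, forall y y',
     tau x (a *: y + y') = a *: tau x y + tau x y'}}).

Definition enorm (R : realType) (n : nat) (e : 'cV[R]_n) : R :=
  Num.sqrt (\sum_(i < n) e i 0 ^+ 2).

(* The library's default norm on matrices is the maximum of the entries, hence
   this separate operator norm for the Euclidean norm. *)
Definition opnorm (R : realType) (n : nat) (A : 'M[R]_n) : R :=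
  sup [set enorm (A *m e) | e in [set e : 'cV[R]_n | enorm e <= 1]]%classic.

Definition pos_semidef (R : realType) (n : nat) (A : 'M[R]_n) : Prop :=
  A^T = A /\ forall e : 'cV[R]_n, 0 <= (e^T *m A *m e) 0 0.

Definition vdot (R : realType) (V : lmodType R) (n : nat)
    (x : 'I_n -> V) (e : 'cV[R]_n) : V :=
  \sum_(i < n) e i 0 *: x i.

(* A is an admissible choice of the reducing matrix of x for the quasi-norm q,
   with equivalence constant c. *)
Definition reducing_matrix (R : realType) (V : lmodType R) (q : V -> R) (c : R)
    (n : nat) (x : 'I_n -> V) (A : 'M[R]_n) : Prop :=
  pos_semidef A /\
  forall e : 'cV[R]_n,
    c^-1 * enorm (A *m e) <= q (vdot x e) <= c * enorm (A *m e).

(* Main.v *)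
(* For dual bases u_k, v_k of R^n, bilinearity gives
   sum_i tau(f_i, g_i) = sum_k tau(f . u_k, g . v_k), so it suffices to choose
   them with |F_j u_k| |G_j v_k| <= |F_j G_j| for both j = 0, 1. Choose the u_k
   to diagonalize the quadratic forms |F_0 u|^2 and |F_1 u|^2 simultaneously.
   Then F_j^2 u_k = |F_j u_k|^2 v_k, whence
   |F_j u_k|^2 |G_j v_k| = |G_j F_j (F_j u_k)| <= |F_j G_j| |F_j u_k|. *)
Require Import Defs.
From HB Require Import structures.
From mathcomp Require Import all_boot all_order all_algebra.
From mathcomp Require Import classical_sets reals.
From mathcomp Require Import spectral complex ring lra.

Set Implicit Arguments.
Unset Strict Implicit.
Unset Printing Implicit Defensive.
Import Order.TTheory GRing.Theory Num.Theory.
Local Open Scope ring_scope.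

(** * Real generalized eigenvectors from complex ones *)

Lemma map_Re_mulmx (R : rcfType) m n p (w : 'M[R[i]]_(m, n)) (B : 'M[R]_(n, p)) :
  map_mx (@complex.Re R) (w *m map_mx (real_complex R) B) =
  map_mx (@complex.Re R) w *m B.
Proof.
apply/matrixP => i j; rewrite !mxE.
rewrite (big_morph (@complex.Re R) (id1 := 0) (op1 := +%R)) //; last first.
  by case=> ? ? [].
by apply: eq_bigr => k _; rewrite !mxE; case: (w i k) => a b /=; ring.
Qed.

Lemma map_Im_mulmx (R : rcfType) m n p (w : 'M[R[i]]_(m, n)) (B : 'M[R]_(n, p)) :
  map_mx (@complex.Im R) (w *m map_mx (real_complex R) B) =
  map_mx (@complex.Im R) w *m B.
Proof.
apply/matrixP => i j; rewrite !mxE.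
rewrite (big_morph (@complex.Im R) (id1 := 0) (op1 := +%R)) //; last first.
  by case=> ? ? [].
by apply: eq_bigr => k _; rewrite !mxE; case: (w i k) => a b /=; ring.
Qed.

Lemma mulmx_form_sym (R : comNzRingType) n (A : 'M[R]_n) (x y : 'rV[R]_n) :
  A^T = A -> x *m A *m y^T = y *m A *m x^T.
Proof.
move=> sA; have -> : x *m A *m y^T = (x *m A *m y^T)^T.
  by apply/matrixP => i j; rewrite !ord1 [RHS]mxE.
by rewrite !trmx_mul trmxK sA mulmxA.
Qed.

(* Over R[i] an eigenvector x + i y, with eigenvalue a + i b, always exists;
   symmetry gives b (x S x^T + y S y^T) = 0, so b = 0 and x or y will do. *)
Lemma generalized_eigenvector (R : rcfType) n (A S : 'M[R]_n) :
  (0 < n)%N -> A^T = A -> S^T = S ->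
  (forall x : 'rV[R]_n, x != 0 -> 0 < (x *m S *m x^T) 0 0) ->
  exists u : 'rV[R]_n, exists l : R, u != 0 /\ u *m A = l *: (u *m S).
Proof.
move=> n0 sA sS pS.
have uS : S \in unitmx.
  rewrite -row_free_unit; apply: inj_row_free => v vS.
  by apply/eqP/negPn/negP => /pS; rewrite vS mul0mx mxE ltxx.
(* Over [R[i]], w A S^-1 = (a + ib) w, that is, w A = (a + ib) w S. As A and S are real, [xE] and
   [yE] are the real and imaginary parts of this relation. *)
have [[a b] /eigenvalueP[w wE w0]] :=
  eigenvalue_closed (map_mx (real_complex R) (A *m invmx S)) n0.
pose x := map_mx (@complex.Re R) w; pose y := map_mx (@complex.Im R) w.
have xE : x *m A = a *: (x *m S) - b *: (y *m S).
  rewrite -[A](mulmxKV uS) mulmxA -map_Re_mulmx wE !scalemxAl -mulmxBl.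
  by congr (_ *m _); apply/rowP => j; rewrite !mxE; case: (w 0 j).
have yE : y *m A = a *: (y *m S) + b *: (x *m S).
  rewrite -[A](mulmxKV uS) mulmxA -map_Im_mulmx wE !scalemxAl -mulmxDl.
  by congr (_ *m _); apply/rowP => j; rewrite !mxE; case: (w 0 j).
have xy0 : (x != 0) || (y != 0).
  rewrite -negb_and; apply: contra w0 => /andP[/eqP/rowP x0 /eqP/rowP y0].
  apply/eqP/rowP => j; move: (x0 j) (y0 j); rewrite !mxE.
  by case: (w 0 j) => ? ? /= -> ->.
have pS' (z : 'rV[R]_n) : 0 <= (z *m S *m z^T) 0 0.
  by have [->|/pS/ltW//] := eqVneq z 0; rewrite mul0mx mul0mx mxE.
have b0 : b = 0.
  have := mulmx_form_sym x y sA; rewrite xE yE mulmxBl mulmxDl -!scalemxAl.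
  rewrite (mulmx_form_sym x y sS).
  set p := x *m S *m x^T; set q := y *m S *m y^T; set r := y *m S *m x^T.
  move=> e; have /eqP : b * (p 0 0 + q 0 0) = 0.
    move: p q r e => p q r /matrixP/(_ 0 0); rewrite !mxE => e; lra.
  rewrite mulf_eq0 => /orP[/eqP//|].
  have px := pS' x; have py := pS' y.
  rewrite paddr_eq0// => /andP[/eqP p0 /eqP q0].
  case/orP: xy0 => /pS; first by rewrite p0 ltxx.
  by rewrite q0 ltxx.
rewrite b0 !scale0r subr0 addr0 in xE yE.
by case/orP: xy0 => ?; [exists x|exists y]; exists a.
Qed.

(** * Simultaneous diagonalization of two quadratic forms *)

Lemma hyperplane_basis (R : fieldType) n (l : 'cV[R]_n.+1) : l != 0 ->
  exists2 H : 'M[R]_(n, n.+1), row_free H & H *m l = 0.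
Proof.
move=> l0; have rK : \rank (kermx l) = n.
  by rewrite mxrank_ker -(mxrank_tr l) rank_rV trmx_eq0 l0 subn1.
have := row_base_free (kermx l).
have : row_base (kermx l) *m l = 0 by apply/sub_kermxP; rewrite eq_row_base.
by move: (row_base _); rewrite rK => H; exists H.
Qed.

Lemma mul_trmx_ge0 (R : realFieldType) n (x : 'rV[R]_n) : 0 <= (x *m x^T) 0 0.
Proof. by rewrite mxE sumr_ge0// => i _; rewrite !mxE -expr2 sqr_ge0. Qed.

Lemma mul_trmx_eq0 (R : realFieldType) n (x : 'rV[R]_n) :
  ((x *m x^T) 0 0 == 0) = (x == 0).
Proof.
apply/idP/eqP => [|->]; last by rewrite mul0mx mxE.
rewrite mxE psumr_eq0 => [/allP x0|i _]; last by rewrite !mxE -expr2 sqr_ge0.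
apply/rowP => j; have := x0 j (mem_index_enum _).
by rewrite !mxE mulf_eq0 orbb => /eqP.
Qed.

(* If some u != 0 is annihilated by both M and N, any l with u *m l != 0 works;
   otherwise S := M M^T + N N^T is positive definite, and u is taken to be an
   eigenvector of M M^T relative to S, with l := (u S)^T. *)
Lemma splitting_vector (R : rcfType) n p q (M : 'M[R]_(n, p)) (N : 'M[R]_(n, q)) :
  (0 < n)%N ->
  exists u : 'rV[R]_n, exists l : 'cV[R]_n, [/\ u *m l != 0,
    forall w : 'rV[R]_n, w *m l = 0 -> w *m M *m (u *m M)^T = 0 &
    forall w : 'rV[R]_n, w *m l = 0 -> w *m N *m (u *m N)^T = 0].
Proof.
move=> n0; pose S := M *m M^T + N *m N^T.
have SE (x : 'rV[R]_n) : (x *m S *m x^T) 0 0 =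
    (x *m M *m (x *m M)^T) 0 0 + (x *m N *m (x *m N)^T) 0 0.
  by rewrite mulmxDr mulmxDl mxE !trmx_mul !mulmxA.
have [[u]|pS] := boolp.pselect (exists2 u : 'rV[R]_n, u != 0 & (u *m S *m u^T) 0 0 = 0).
  move=> u0 /eqP; rewrite SE paddr_eq0 ?mul_trmx_ge0// !mul_trmx_eq0.
  move=> /andP[/eqP uM /eqP uN]; exists u, u^T; split=> [|w _|w _].
  - apply: contra u0 => /eqP e; by rewrite -mul_trmx_eq0 e mxE.
  - by rewrite uM trmx0 mulmx0.
  - by rewrite uN trmx0 mulmx0.
have {}pS (x : 'rV[R]_n) : x != 0 -> 0 < (x *m S *m x^T) 0 0.
  move=> x0; rewrite lt_neqAle SE addr_ge0 ?mul_trmx_ge0// andbT -SE eq_sym.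
  by apply/eqP => e; apply: pS; exists x.
have sMM : (M *m M^T)^T = M *m M^T by rewrite trmx_mul trmxK.
have sNN : (N *m N^T)^T = N *m N^T by rewrite trmx_mul trmxK.
have sS : S^T = S by rewrite raddfD /= sMM sNN.
have [u [a [u0 uE]]] := generalized_eigenvector n0 sMM sS pS.
(* M M^T is symmetric and u M M^T = a u S, so pairing w with u under the form of M gives a times the
   pairing under S. *)
have oM (w : 'rV[R]_n) : w *m (u *m S)^T = 0 -> w *m M *m (u *m M)^T = 0.
  move=> w0; rewrite trmx_mul mulmxA -(mulmxA w) -[M *m _]sMM -mulmxA -trmx_mul.
  by rewrite uE linearZ /= -scalemxAr w0 scaler0.
exists u, (u *m S)^T; split=> // [|w w0].
  apply/eqP => /matrixP/(_ 0 0); rewrite trmx_mul sS mulmxA [RHS]mxE => e.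
  by have := pS _ u0; rewrite e ltxx.
(* The form of N is that of S minus that of M, and both of these vanish on the pair w, u. *)
have := w0; rewrite trmx_mul sS mulmxDl mulmxDr -!mulmxA -!trmx_mul !mulmxA.
by rewrite oM// add0r.
Qed.

(** Induction on n: split off u, orthogonal for both forms to the hyperplane w l = 0, and
    diagonalize the restrictions to that hyperplane. The factors are rectangular so that the
    restrictions, with factors [H *m M] and [H *m N], have the same shape. *)
Lemma simultaneous_diagonalization (R : rcfType) n p q
    (M : 'M[R]_(n, p)) (N : 'M[R]_(n, q)) :
  exists2 U : 'M[R]_n, U \in unitmx &
    is_diag_mx (U *m M *m (U *m M)^T) && is_diag_mx (U *m N *m (U *m N)^T).
Proof.
elim: n M N => [|n IH] M N.
  exists 1%:M; first exact: unitmx1.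
  by apply/andP; split; apply/is_diag_mxP => -[].
have [u [l [ul oM oN]]] := splitting_vector M N (ltn0Sn n).
have l0 : l != 0 by apply: contra ul => /eqP->; rewrite mulmx0.
have [H fH Hl] := hyperplane_basis l0.
have [U uU /andP[dM dN]] := IH (H *m M) (H *m N).
exists (col_mx u (U *m H)).
  rewrite -row_free_unit; apply: inj_row_free.
  suff inj (v : 'M_(1, 1 + n)) : v *m col_mx u (U *m H) = 0 -> v = 0 by [].
  rewrite -[v]hsubmxK mul_row_col => e.
  (* Multiplication by l kills the rows of [U *m H], leaving the coefficient of u times the nonzero
     scalar [u *m l]. *)
  have := congr1 (mulmx^~ l) e; rewrite mulmxDl -!mulmxA Hl !mulmx0 addr0 mul0mx.
  rewrite [u *m l]mx11_scalar mul_mx_scalar => /eqP; rewrite scaler_eq0.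
  case/orP=> [/eqP h|/eqP v1].
    by move: ul; rewrite [u *m l]mx11_scalar h raddf0 eqxx.
  move: e; rewrite v1 mul0mx add0r mulmxA => e.
  have {}e : rsubmx v *m U = 0.
    by apply: (row_free_inj fH); rewrite mul0mx.
  have -> : rsubmx v = 0.
    by apply: (row_free_inj (A := U)); rewrite ?row_free_unit// mul0mx.
  exact: row_mx0.
have aux r (B : 'M[R]_(n.+1, r)) :
    (forall w : 'rV_n.+1, w *m l = 0 -> w *m B *m (u *m B)^T = 0) ->
    is_diag_mx (U *m (H *m B) *m (U *m (H *m B))^T) ->
    is_diag_mx ((col_mx u (U *m H) *m B *m (col_mx u (U *m H) *m B)^T) : 'M_(1 + n)).
  move=> oB; rewrite !mulmxA => dB.
  (* The off-diagonal block of the Gram matrix vanishes because the rows of [U *m H] lie in the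
     hyperplane w l = 0. *)
  have o0 : U *m H *m B *m (u *m B)^T = 0.
    apply/row_matrixP => i; rewrite !row_mul row0 oB//.
    by rewrite -mulmxA Hl mulmx0.
  rewrite mul_col_mx tr_col_mx mul_col_row is_diag_block_mx// o0 eqxx.
    rewrite mx11_is_diag dB !andbT -trmx_eq0 trmx_mul trmxK.
  by rewrite o0.
by apply/andP; split; apply: aux.
Qed.

(** * Finite sums in quasi-normed spaces and bilinear expansions *)

Lemma quasi_norm_sum (R : realType) (Z : lmodType R) (q : Z -> R) (K : R) n
    (z : 'I_n -> Z) :
  quasi_norm predT q K -> q (\sum_(i < n) z i) <= K ^+ n * \sum_(i < n) q (z i).
Proof.
case=> K1 q0 _ qZ qD; elim: n z => [|n IH] z.
  by rewrite !big_ord0 mulr0 -(scale0r 0) qZ// normr0 mul0r.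
rewrite !big_ord_recl (le_trans (qD _ _ _ _))// exprS -mulrA.
(* One factor K is spent per summand; the head term absorbs the remaining [K ^+ n], which is at
   least 1. *)
rewrite ler_wpM2l ?(le_trans ler01)// mulrDr lerD// ler_peMl ?q0//.
exact: exprn_ege1.
Qed.

(** Both conclusions go through one induction, since linearity of T is available only for vectors
    already known to lie in A. *)
Lemma linear_on_vdot (R : realType) (V Z : lmodType R) (A : {pred V})
    (T : V -> Z) n (x : 'I_n -> V) (e : 'cV[R]_n) :
  GRing.submod_closed A ->
  (forall a : R, {in A &, forall x y, T (a *: x + y) = a *: T x + T y}) ->
  (forall i, x i \in A) ->
  vdot x e \in A /\ T (vdot x e) = \sum_(i < n) e i 0 *: T (x i).
Proof.
move=> [A0 AD] TD xA; rewrite /vdot; elim/big_rec2: _ => [|i y z _ [zA Tz]].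
  (* For the empty sum, T 0 = T 0 + T 0 forces T 0 = 0. *)
  split=> //; have := TD 1 _ _ A0 A0; rewrite !scale1r addr0 => /eqP.
  by rewrite -subr_eq0 opprD addNKr oppr_eq0 => /eqP.
by rewrite AD// TD// Tz.
Qed.

Lemma submod_closed_predI (R : realType) (V : lmodType R) (X0 X1 : submodClosed V) :
  GRing.submod_closed [predI X0 & X1].
Proof.
split=> [|a x y /andP[x0 x1] /andP[y0 y1]]; first by rewrite inE !rpred0.
by rewrite inE !rpredD ?rpredZ.
Qed.

(** After expansion, tau (x i) (y j) has the coefficient (U^-1 U)_ji, which is 1 for i = j and 0
    otherwise. *)
Lemma bilinear_on_dual_basis (R : realType) (V W Z : lmodType R)
    (A : {pred V}) (B : {pred W}) (tau : V -> W -> Z) n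
    (x : 'I_n -> V) (y : 'I_n -> W) (U : 'M[R]_n) :
  GRing.submod_closed A -> GRing.submod_closed B -> bilinear_on A B tau ->
  (forall i, x i \in A) -> (forall i, y i \in B) -> U \in unitmx ->
  \sum_(i < n) tau (x i) (y i) =
  \sum_(k < n) tau (vdot x (col k U^T)) (vdot y (col k (invmx U))).
Proof.
move=> sA sB [tl tr] xA yB uU.
have yvB e : vdot y e \in B by apply: (linear_on_vdot (T := id) e sB _ yB).1.
have tE k : tau (vdot x (col k U^T)) (vdot y (col k (invmx U))) =
    \sum_(i < n) \sum_(j < n) (invmx U j k * U k i) *: tau (x i) (y j).
  rewrite (linear_on_vdot (T := tau^~ _) _ sA _ xA).2; last first.
    by move=> a u v uA vA; apply: tl.
  apply: eq_bigr => i _; rewrite (linear_on_vdot (T := tau _) _ sB _ yB).2.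
    rewrite scaler_sumr; apply: eq_bigr => j _.
    by rewrite !mxE scalerA mulrC.
  by move=> a; apply: tr.
rewrite (eq_bigr _ (fun k _ => tE k)) exchange_big /=; apply: eq_bigr => i _.
rewrite exchange_big /= (bigD1 i)//= [X in _ + X]big1 => [|j ji].
  rewrite addr0 -scaler_suml; have /matrixP/(_ i i) := mulVmx uU.
  by rewrite !mxE eqxx => ->; rewrite scale1r.
rewrite -scaler_suml; have /matrixP/(_ j i) := mulVmx uU.
by rewrite !mxE (negPf ji) => ->; rewrite scale0r.
Qed.

(** * Euclidean norm, operator norm and the estimate for a dual pair *)

Section EuclideanNorm.
Variables (R : realType) (n : nat).
Implicit Types (e f x : 'cV[R]_n) (A F G U : 'M[R]_n).

Lemma enorm_ge0 e : 0 <= enorm e. Proof. exact: sqrtr_ge0. Qed.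

Lemma sqr_enorm e : enorm e ^+ 2 = (e^T *m e) 0 0.
Proof.
rewrite sqr_sqrtr ?sumr_ge0// => [|i _]; last exact: sqr_ge0.
by rewrite mxE; apply: eq_bigr => i _; rewrite mxE expr2.
Qed.

Lemma enorm_eq0 e : enorm e = 0 -> e = 0.
Proof.
move=> e0; have := sqr_enorm e; rewrite e0 expr0n -{2}[e]trmxK => /esym/eqP.
by rewrite mul_trmx_eq0 trmx_eq0 => /eqP.
Qed.

Lemma enormZ (a : R) e : enorm (a *: e) = `|a| * enorm e.
Proof.
apply/eqP; rewrite -(@eqrXn2 _ 2) ?mulr_ge0 ?enorm_ge0//.
rewrite exprMn real_normK ?num_real// !sqr_enorm [(_ *: _)^T]linearZ -scalemxAl -scalemxAr.
by rewrite scalerA mxE expr2.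
Qed.

Lemma Cauchy_Schwarz e f : (e^T *m f) 0 0 ^+ 2 <= enorm e ^+ 2 * enorm f ^+ 2.
Proof.
have [->|f0] := eqVneq f 0.
  by rewrite mulmx0 mxE expr0n mulr_ge0 ?exprn_ge0 ?enorm_ge0.
have ffgt0 : 0 < enorm f ^+ 2.
  rewrite exprn_gt0// lt_neqAle enorm_ge0 andbT eq_sym.
  by apply: contra f0 => /eqP/enorm_eq0->.
have sym : f^T *m e = e^T *m f.
  by apply/matrixP => i j; rewrite !ord1 !mxE; apply: eq_bigr => k _; rewrite !mxE mulrC.
(* The squared norm of |f|^2 e - (e.f) f equals |f|^2 (|e|^2 |f|^2 - (e.f)^2). *)
have := sqr_ge0 (enorm (enorm f ^+ 2 *: e - (e^T *m f) 0 0 *: f)).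
rewrite [X in 0 <= X -> _]sqr_enorm [(_ - _)^T]linearB /= ![(_ *: _)^T]linearZ /=.
rewrite mulmxBl !mulmxBr -!scalemxAl -!scalemxAr sym => h.
have : 0 <= enorm f ^+ 2 * (enorm e ^+ 2 * enorm f ^+ 2 - (e^T *m f) 0 0 ^+ 2).
  move: h; rewrite !sqr_enorm.
  move: (e^T *m f) (e^T *m e) (f^T *m f) => r p q; rewrite !mxE => h; lra.
by rewrite pmulr_rge0// subr_ge0.
Qed.

Lemma dotmx_le e f : (e^T *m f) 0 0 <= enorm e * enorm f.
Proof.
rewrite (le_trans (ler_norm _))// -ler_sqr ?nnegrE ?mulr_ge0 ?enorm_ge0//.
by rewrite real_normK ?num_real// exprMn Cauchy_Schwarz.
Qed.

(** Cauchy-Schwarz on each row gives the Frobenius norm as a bound. It shows that the supremum in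
    [opnorm] is taken over a bounded set. *)
Lemma enorm_mulmx_bounded A e :
  enorm (A *m e) <= Num.sqrt (\sum_(i < n) enorm (row i A)^T ^+ 2) * enorm e.
Proof.
have S0 : 0 <= \sum_(i < n) enorm (row i A)^T ^+ 2.
  by rewrite sumr_ge0// => i _; apply: sqr_ge0.
rewrite -ler_sqr ?nnegrE ?mulr_ge0 ?sqrtr_ge0 ?enorm_ge0// exprMn.
rewrite (sqr_sqrtr S0) {1}/enorm sqr_sqrtr ?sumr_ge0// => [|i _]; last first.
  exact: sqr_ge0.
rewrite mulr_suml ler_sum// => i _; apply: le_trans (Cauchy_Schwarz _ _).
by rewrite trmxK -row_mul [row _ _ _ _]mxE.
Qed.

Lemma has_ubound_opnorm A :
  has_ubound [set enorm (A *m e) | e in [set e : 'cV[R]_n | enorm e <= 1]]%classic.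
Proof.
exists (Num.sqrt (\sum_(i < n) enorm (row i A)^T ^+ 2)) => _ [e /= e1 <-].
by rewrite (le_trans (enorm_mulmx_bounded _ _))// ler_piMr ?sqrtr_ge0.
Qed.

Lemma opnorm_ge0 A : 0 <= opnorm A.
Proof.
apply: ub_le_sup; [exact: has_ubound_opnorm|]; exists 0 => /=.
  by rewrite -(scale0r 0) enormZ normr0 mul0r.
by rewrite mulmx0 -(scale0r 0) enormZ normr0 mul0r.
Qed.

Lemma enorm_mulmx_le A e : enorm (A *m e) <= opnorm A * enorm e.
Proof.
have [->|e0] := eqVneq e 0.
  by rewrite mulmx0 -(scale0r 0) enormZ normr0 !mul0r mulr0.
have egt0 : 0 < enorm e.
  by rewrite lt_neqAle enorm_ge0 andbT eq_sym; apply: contra e0 => /eqP/enorm_eq0->.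
rewrite -ler_pdivrMr//; apply: ub_le_sup; first exact: has_ubound_opnorm.
exists ((enorm e)^-1 *: e) => /=.
  by rewrite enormZ ger0_norm ?invr_ge0 ?enorm_ge0// mulVf// gt_eqF.
by rewrite -scalemxAr enormZ ger0_norm ?invr_ge0 ?enorm_ge0// mulrC.
Qed.

(** |A^T x|^2 = x.(A A^T x) <= |x| |A| |A^T x|; divide by |A^T x|. With A = F G this bounds G F by
    |F G|. *)
Lemma enorm_trmx_mul_le A x : enorm (A^T *m x) <= opnorm A * enorm x.
Proof.
have [->|y0] := eqVneq (enorm (A^T *m x)) 0.
  by rewrite mulr_ge0 ?opnorm_ge0 ?enorm_ge0.
have ygt0 : 0 < enorm (A^T *m x) by rewrite lt_neqAle eq_sym y0 enorm_ge0.
rewrite -(ler_pM2r ygt0) -expr2 sqr_enorm trmx_mul trmxK -mulmxA.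
by rewrite (le_trans (dotmx_le _ _))// mulrAC mulrC ler_wpM2r ?enorm_ge0 ?enorm_mulmx_le.
Qed.

Lemma enorm_dual_pair_le F G U k : F^T = F -> G^T = G -> U \in unitmx ->
  is_diag_mx (U *m F *m (U *m F)^T) ->
  enorm (F *m col k U^T) * enorm (G *m col k (invmx U)) <= opnorm (F *m G).
Proof.
move=> sF sG uU /diag_mxP[d dE].
set u := col k U^T; set v := col k (invmx U).
(* By symmetry of F, U F (U F)^T = D becomes F F U^T = U^-1 D; this is its k-th column. *)
have FFu : F *m (F *m u) = d 0 k *: v.
  have FFU : F *m F *m U^T = invmx U *m diag_mx d.
    by rewrite -dE trmx_mul sF !mulmxA mulVmx// mul1mx.
  rewrite /u /v !colE !mulmxA FFU -mulmxA scalemxAr; congr (_ *m _).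
  apply/colP => i; rewrite mul_diag_mx !mxE.
  by have [->|] := eqVneq i k; rewrite ?mulr0.
have dk : d 0 k = enorm (F *m u) ^+ 2.
  rewrite sqr_enorm trmx_mul sF -mulmxA FFu -scalemxAr.
  have -> : u^T *m v = 1%:M.
    have /matrixP/(_ k k) := mulmxV uU; rewrite !mxE eqxx => UV.
    apply/matrixP => i j; rewrite !ord1 !mxE eqxx -UV.
    by apply: eq_bigr => l _; rewrite !mxE.
  by rewrite !mxE eqxx mulr1.
(* Here (F G)^T F u = G F F u = |F u|^2 G v, so one factor |F u| cancels unless it is zero, when the
   claim is trivial. *)
have := enorm_trmx_mul_le (F *m G) (F *m u).
rewrite trmx_mul sF sG -mulmxA FFu -scalemxAr enormZ dk normrX ger0_norm ?enorm_ge0//.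
have [->|Fu0] := eqVneq (enorm (F *m u)) 0; first by rewrite !mul0r opnorm_ge0.
rewrite expr2 -mulrA mulrC ler_pM2r//.
by rewrite lt_neqAle eq_sym Fu0 enorm_ge0.
Qed.
End EuclideanNorm.

(** * The estimate for the bilinear operator *)

Theorem theorem5p5 (R : realType)
  (c : nat -> R -> R) (hc : forall (m : nat) (K : R), 1 <= K -> 1 <= c m K)
  (n : nat) (hn : (1 <= n)%N) (KX0 KX1 KY0 KY1 KZ : R) :
  exists C : R,
  forall (V W Z : lmodType R)
    (X0 X1 : submodClosed V) (Y0 Y1 : submodClosed W)
    (qX0 qX1 : V -> R) (qY0 qY1 : W -> R) (qZ : Z -> R)
    (tau : V -> W -> Z),
  quasi_norm X0 qX0 KX0 -> quasi_norm X1 qX1 KX1 ->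
  quasi_norm Y0 qY0 KY0 -> quasi_norm Y1 qY1 KY1 ->
  quasi_norm predT qZ KZ ->
  bilinear_on [predI X0 & X1] [predI Y0 & Y1] tau ->
  (forall f g, f \in [predI X0 & X1] -> g \in [predI Y0 & Y1] ->
     qZ (tau f g) <= qX0 f * qY0 g + qX1 f * qY1 g) ->
  forall (f : 'I_n -> V) (g : 'I_n -> W),
  (forall i, f i \in [predI X0 & X1]) ->
  (forall i, g i \in [predI Y0 & Y1]) ->
  forall F0 F1 G0 G1 : 'M[R]_n,
  reducing_matrix qX0 (c n KX0) f F0 -> reducing_matrix qX1 (c n KX1) f F1 ->
  reducing_matrix qY0 (c n KY0) g G0 -> reducing_matrix qY1 (c n KY1) g G1 ->
  qZ (\sum_(i < n) tau (f i) (g i)) <=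
    C * (opnorm (F0 *m G0) + opnorm (F1 *m G1)).
Proof.
pose C0 := c n KX0 * c n KY0; pose C1 := c n KX1 * c n KY1.
(* [KZ ^+ n] comes from splitting the quasi-norm of a sum of n terms, [n%:R] from bounding each term
   alike, [C0] and [C1] from replacing quasi-norms by reducing matrices. *)
exists (KZ ^+ n * n%:R * (C0 + C1)).
move=> V W Z X0 X1 Y0 Y1 qX0 qX1 qY0 qY1 qZ tau nX0 nX1 nY0 nY1 nZ btau tauE.
move=> f g fX gY F0 F1 G0 G1.
move=> [[sF0 _] rF0] [[sF1 _] rF1] [[sG0 _] rG0] [[sG1 _] rG1].
have cX0 : 0 <= c n KX0 by case: nX0 => /hc/(le_trans ler01).
have cX1 : 0 <= c n KX1 by case: nX1 => /hc/(le_trans ler01).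
have cY0 : 0 <= c n KY0 by case: nY0 => /hc/(le_trans ler01).
have cY1 : 0 <= c n KY1 by case: nY1 => /hc/(le_trans ler01).
have KZ0 : 0 <= KZ by case: nZ => /(le_trans ler01).
have sX := submod_closed_predI X0 X1; have sY := submod_closed_predI Y0 Y1.
(* The columns of [U^T] and [invmx U] are the dual bases; one U must serve both F0 and F1. *)
have [U uU /andP[dF0 dF1]] := simultaneous_diagonalization F0 F1.
rewrite (bilinear_on_dual_basis sX sY btau fX gY uU).
rewrite (le_trans (quasi_norm_sum _ nZ))// -!mulrA ler_wpM2l ?exprn_ge0//.
have -> : n%:R = \sum_(k < n) 1 :> R by rewrite sumr_const card_ord.
rewrite mulr_suml ler_sum// => k _; rewrite mul1r.
set u := col k U^T; set v := col k (invmx U).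
have uX : vdot f u \in [predI X0 & X1].
  by apply: (linear_on_vdot (T := id) u sX _ fX).1.
have vY : vdot g v \in [predI Y0 & Y1].
  by apply: (linear_on_vdot (T := id) v sY _ gY).1.
apply: le_trans (tauE _ _ uX vY) _.
have [uX0 uX1] := andP uX; have [vY0 vY1] := andP vY.
have bound (qX : V -> R) (qY : W -> R) a b F G :
    0 <= qX (vdot f u) -> 0 <= qY (vdot g v) -> 0 <= a -> 0 <= b ->
    qX (vdot f u) <= a * enorm (F *m u) ->
    qY (vdot g v) <= b * enorm (G *m v) ->
    enorm (F *m u) * enorm (G *m v) <= opnorm (F *m G) ->
    qX (vdot f u) * qY (vdot g v) <= a * b * opnorm (F *m G).
  move=> x0 y0 a0 b0 xF yG FG; rewrite (le_trans (ler_pM x0 y0 xF yG))//.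
  by rewrite mulrACA ler_wpM2l ?mulr_ge0.
have C0_ge0 : 0 <= C0 by rewrite mulr_ge0.
have C1_ge0 : 0 <= C1 by rewrite mulr_ge0.
have o0 := opnorm_ge0 (F0 *m G0); have o1 := opnorm_ge0 (F1 *m G1).
have b0 : qX0 (vdot f u) * qY0 (vdot g v) <= C0 * opnorm (F0 *m G0).
  apply: bound => //; last exact: enorm_dual_pair_le.
  - by case: nX0 => _ q0 _ _ _; apply: q0.
  - by case: nY0 => _ q0 _ _ _; apply: q0.
  - by case/andP: (rF0 u).
  - by case/andP: (rG0 v).
have b1 : qX1 (vdot f u) * qY1 (vdot g v) <= C1 * opnorm (F1 *m G1).
  apply: bound => //; last exact: enorm_dual_pair_le.
  - by case: nX1 => _ q0 _ _ _; apply: q0.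
  - by case: nY1 => _ q0 _ _ _; apply: q0.
  - by case/andP: (rF1 u).
  - by case/andP: (rG1 v).
(* The nonnegative cross terms of (C0 + C1)(|F0 G0| + |F1 G1|) are dropped. *)
apply: le_trans (lerD b0 b1) _; rewrite mulrDl !mulrDr.
by rewrite lerD// ?lerDl ?lerDr mulr_ge0.
Qed.
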